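(* Let $p\ge2$ be an integer, $r\in\{0,\dots,p-1\}$, $f:\mathbb{Z}_p\to\mathbb{Z}_p$ a function, and $g=\sum_{i=0}^da_ix^i\in\mathbb{Q}_p[x]$ (with the convention $0^0:=1$) a polynomial with $g(r+p\mathbb{Z}_p)\subseteq\mathbb{Z}_p$ and $f(n)=g(n)$ for all $n\in r+p\mathbb{Z}_p$. Let $k\ge0$ be an integer, put $W_\ell:=\{0,\dots,p^\ell-1\}\cap(r+p\mathbb{Z}_p)$ for all integers $\ell\ge0$, and $K:=-\min\big(\{\nu_p(a_i)\mid 0\le i\le d\}\cup\{0\}\big)$. Write $\tilde f(n):=f(n)-(f(n)\,\%\,p)$. Then $W_{K+k}$ is a finite witness set for $f$ being (weakly) $(p,r)$-suitable at $k$, i.e.: (1) $f$ is weakly $(p,r)$-suitable at $k$ if and only if for all $m,n\in W_{K+k}$: $m\equiv n\pmod{p^k}\Rightarrow\tilde f(m)\equiv\tilde f(n)\pmod{p^k}$. (2) $f$ is $(p,r)$-suitable at $k$ if and only if for all $m,n\in W_{K+k}$: $m\equiv n\pmod{p^k}\Leftrightarrow\tilde f(m)\equiv\tilde f(n)\pmod{p^k}$. Furthermore: (3) For all integers $\ell\ge K+1$: if $f$ is weakly $(p,r)$-suitable at $\ell$, then it is weakly $(p,r)$-suitable at $\ell+1$. In particular, $f$ is weakly $(p,r)$-suitable at $\{\ell\in\mathbb{Z}\mid\ell\ge K+1\}$ if and only if it is weakly $(p,r)$-suitable at $K+1$. (4) For all integers $\ell\ge K+2$: if $f$ is weakly $(p,r)$-suitable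 at $\ell$ and $(p,r)$-suitable at $\ell+1$, then it is $(p,r)$-suitable at $\ell+2$. In particular, $f$ is $(p,r)$-suitable at $\{\ell\in\mathbb{Z}\mid\ell\ge K+2\}$ if and only if it is $(p,r)$-suitable at $\{K+2,K+3\}$. In particular: (1') $f$ is weakly $(p,r)$-suitable if and only if it is weakly $(p,r)$-suitable at $\{0,\dots,K+1\}$, if and only if for all $\ell\in\{0,\dots,K+1\}$ and all $m,n\in W_{K+\ell}$: $m\equiv n\pmod{p^\ell}\Rightarrow\tilde f(m)\equiv\tilde f(n)\pmod{p^\ell}$. (2') $f$ is $(p,r)$-suitable if and only if it is $(p,r)$-suitable at $\{0,\dots,K+3\}$, if and only if for all $\ell\in\{0,\dots,K+3\}$ and all $m,n\in W_{K+\ell}$: $m\equiv n\pmod{p^\ell}\Leftrightarrow\tilde f(m)\equiv\tilde f(n)\pmod{p^\ell}$.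
   Context: $p\ge2$ is an integer, not necessarily prime. $\mathbb{Z}_p=\varprojlim \mathbb{Z}/p^k\mathbb{Z}$; every $a\in\mathbb{Z}_p$ is uniquely $a=\sum_{i\ge0}a_ip^i$ with $a_i\in\{0,\dots,p-1\}$, and $a\,\%\,p:=a_0$. $\mathbb{Q}_p=\mathbb{Z}_p[1/p]$. For $x\in\mathbb{Q}_p$: $\nu_p(x)=\max\{k\in\mathbb{N}_0\mid x/p^k\in\mathbb{Z}_p\}$ if $x\in\mathbb{Z}_p\setminus\{0\}$, $\nu_p(x)=-\min\{k\in\mathbb{N}\mid xp^k\in\mathbb{Z}_p\}$ if $x\in\mathbb{Q}_p\setminus\mathbb{Z}_p$, and $\nu_p(0)=\infty$. For a set $L$ of nonnegative integers, a function $f:\mathbb{Z}_p\to\mathbb{Z}_p$ is weakly $(p,r)$-suitable at $L$ if for all $\ell\in L$ and all $m,n\in r+p\mathbb{Z}_p$: $m\equiv n\pmod{p^\ell}$ implies $f(m)-(f(m)\%p)\equiv f(n)-(f(n)\%p)\pmod{p^\ell}$; it is $(p,r)$-suitable at $L$ if this implication is an equivalence for all such $\ell,m,n$. ''At $\ell$'' means $L=\{\ell\}$; without specification $L=\mathbb{N}_0$. *)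

(* Defs.v *)
From HB Require Import structures.
From mathcomp Require Import all_boot all_order all_algebra.
From mathcomp Require Import ring.
From mathcomp Require Import boolp classical_sets cardinality constructive_ereal.

Set Implicit Arguments.
Unset Strict Implicit.
Unset Printing Implicit Defensive.

Import Order.TTheory GRing.Theory Num.Theory.
Local Open Scope classical_set_scope.
Local Open Scope ring_scope.

(* ------------------------------------------------------------------------ *)
(* Z_p as the inverse limit of the rings Z/p^k, for p >= 2 not nec. prime.   *)
(* The residue ring Z/p^k is represented by the integers in [0, p^k).        *)
(* Elements of Z_p are the sequences (a_k) of residues such that a_k is      *)
(* the reduction of a_{k+1}; since _ %% p^k lies in [0, p^k), the equation   *)
(* below also forces 0 <= a_k < p^k (lemma padic_range).                     *)
(* ------------------------------------------------------------------------ *)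

Record padic (p : nat) (p_gt1 : (1 < p)%N) := Padic {
  residue :> nat -> int;
  residue_coherent : forall k : nat,
    residue k = (residue k.+1 %% (p ^ k)%N%:Z)%Z
}.

Section PadicRing.
Variables (p : nat) (p_gt1 : (1 < p)%N).
Local Notation Zp := (padic p_gt1).
Local Notation pk k := ((p ^ k)%N%:Z).
Implicit Types (a b c : Zp) (k : nat).

HB.instance Definition _ := gen_eqMixin Zp.
HB.instance Definition _ := gen_choiceMixin Zp.

Lemma pk_gt0 k : 0 < pk k.
Proof. by rewrite ltz_nat expn_gt0 (ltnW p_gt1). Qed.

Lemma pk_neq0 k : pk k != 0.
Proof. by rewrite gt_eqF ?pk_gt0. Qed.

Lemma pkS k : pk k.+1 = p%:Z * pk k.
Proof. by rewrite expnS PoszM. Qed.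

Lemma modz_pkS (x : int) k : ((x %% pk k.+1)%Z %% pk k)%Z = (x %% pk k)%Z.
Proof.
rewrite [in RHS](divz_eq x (pk k.+1)) [X in _ * X + _]pkS mulrA.
by rewrite -[in RHS]modzDml modzMl add0r.
Qed.

Lemma padic_eqP a b : (forall k, a k = b k) -> a = b.
Proof.
case: a b => [a Ha] [b Hb] /= /funext ab; move: Hb; rewrite -ab => Hb.
by congr Padic; apply: Prop_irrelevance.
Qed.

Lemma padic_mod a k : (a k %% pk k)%Z = a k.
Proof. by rewrite residue_coherent modz_mod. Qed.

Lemma padic_modS a k : (a k.+1 %% pk k)%Z = a k.
Proof. by rewrite -residue_coherent. Qed.

Lemma padic_range a k : 0 <= a k < pk k.
Proof. by rewrite -padic_mod modz_ge0 ?pk_neq0 //= ltz_pmod ?pk_gt0. Qed.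

Fact mk_coherent (u : nat -> int)
    (H : forall k, (u k.+1 %% pk k)%Z = (u k %% pk k)%Z) k :
  (u k %% pk k)%Z = ((u k.+1 %% pk k.+1)%Z %% pk k)%Z.
Proof. by rewrite modz_pkS H. Qed.

Definition mk_padic u H : Zp := Padic p_gt1 (@mk_coherent u H).

Fact padic_const_subproof (z : int) k : (z %% pk k)%Z = (z %% pk k)%Z.
Proof. by []. Qed.
Definition padic_const z : Zp := mk_padic (padic_const_subproof z).

Fact padic_add_subproof a b k :
  ((a k.+1 + b k.+1) %% pk k)%Z = ((a k + b k) %% pk k)%Z.
Proof. by rewrite -modzDm !padic_modS. Qed.
Definition padic_add a b : Zp := mk_padic (padic_add_subproof a b).

Fact padic_opp_subproof a k : ((- a k.+1) %% pk k)%Z = ((- a k) %% pk k)%Z.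
Proof. by rewrite -modzNm padic_modS. Qed.
Definition padic_opp a : Zp := mk_padic (padic_opp_subproof a).

Fact padic_mul_subproof a b k :
  ((a k.+1 * b k.+1) %% pk k)%Z = ((a k * b k) %% pk k)%Z.
Proof. by rewrite -modzMm !padic_modS. Qed.
Definition padic_mul a b : Zp := mk_padic (padic_mul_subproof a b).

Fact padic_addA : associative padic_add.
Proof. by move=> a b c; apply: padic_eqP => k /=; rewrite modzDml modzDmr addrA. Qed.
Fact padic_addC : commutative padic_add.
Proof. by move=> a b; apply: padic_eqP => k /=; rewrite addrC. Qed.
Fact padic_add0 : left_id (padic_const 0) padic_add.
Proof. by move=> a; apply: padic_eqP => k /=; rewrite modzDml add0r padic_mod. Qed.
Fact padic_addN : left_inverse (padic_const 0) padic_opp padic_add.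
Proof. by move=> a; apply: padic_eqP => k /=; rewrite modzDml addNr. Qed.
HB.instance Definition _ :=
  GRing.isZmodule.Build Zp padic_addA padic_addC padic_add0 padic_addN.

Fact padic_mulA : associative padic_mul.
Proof. by move=> a b c; apply: padic_eqP => k /=; rewrite modzMml modzMmr mulrA. Qed.
Fact padic_mulC : commutative padic_mul.
Proof. by move=> a b; apply: padic_eqP => k /=; rewrite mulrC. Qed.
Fact padic_mul1 : left_id (padic_const 1) padic_mul.
Proof. by move=> a; apply: padic_eqP => k /=; rewrite modzMml mul1r padic_mod. Qed.
Fact padic_mulDl : left_distributive padic_mul padic_add.
Proof.
by move=> a b c; apply: padic_eqP => k /=; rewrite modzMml modzDm mulrDl.
Qed.
Fact padic_1neq0 : padic_const 1 != 0.
Proof.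
apply/eqP => /(congr1 (fun a : Zp => a 1%N)) /=.
by rewrite expn1 mod0z modz_small // ltz_nat.
Qed.
HB.instance Definition _ := GRing.Zmodule_isComNzRing.Build Zp
  padic_mulA padic_mulC padic_mul1 padic_mulDl padic_1neq0.

Lemma residueD a b k : (a + b) k = ((a k + b k) %% pk k)%Z.
Proof. by []. Qed.
Lemma residueN a k : (- a) k = ((- a k) %% pk k)%Z.
Proof. by []. Qed.
Lemma residueM a b k : (a * b) k = ((a k * b k) %% pk k)%Z.
Proof. by []. Qed.
Lemma residue0 k : (0 : Zp) k = 0.
Proof. exact: mod0z. Qed.
Lemma residue_nat (n k : nat) : (n%:R : Zp) k = (n%:Z %% pk k)%Z.
Proof.
elim: n => [|n IHn]; first by rewrite residue0 mod0z.
by rewrite -addn1 natrD residueD IHn modzDm PoszD.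
Qed.

Lemma natX (m k : nat) : (m%:R ^+ k : Zp) = (m ^ k)%N%:R.
Proof. by rewrite natrX. Qed.

Lemma mulp_inj : injective (fun a : Zp => a * p%:R).
Proof.
move=> a b /= ab; apply: padic_eqP => k.
have : (a * p%:R) k.+1 = (b * p%:R) k.+1 by rewrite ab.
rewrite !residueM !residue_nat !modzMmr => /eqP.
rewrite eqz_mod_dvd -mulrBl pkS mulrC dvdz_mul2l; last first.
  by rewrite eqz_nat; case: (p) p_gt1.
by rewrite -eqz_mod_dvd !padic_modS => /eqP.
Qed.

Lemma mulpX_inj n : injective (fun a : Zp => a * p%:R ^+ n).
Proof.
elim: n => [|n IHn] a b /=; first by rewrite !expr0 !mulr1.
by rewrite exprSr !mulrA => /mulp_inj /IHn.
Qed.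

(* The digits of the expansion a = sum_(i >= 0) a_i p^i, 0 <= a_i < p.       *)
Definition digit a (i : nat) : int := (a i.+1 %/ pk i)%Z.

Lemma digit_range a i : 0 <= digit a i < p%:Z.
Proof.
have /andP[a0 a1] := padic_range a i.+1.
by rewrite /digit divz_ge0 ?pk_gt0 // a0 ltz_divLR ?pk_gt0 // -pkS.
Qed.

Lemma digit_expansion a k : a k = \sum_(i < k) digit a i * pk i.
Proof.
elim: k => [|k IHk].
  rewrite big_ord0; have := padic_range a 0; rewrite expn0.
  by case: (residue a 0) => // -[].
by rewrite big_ord_recr /= -IHk -(padic_modS a k) addrC -divz_eq.
Qed.

End PadicRing.

(* a % p := a_0 *)
Definition padic_rem (p : nat) (p_gt1 : (1 < p)%N) (a : padic p_gt1) : int :=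
  digit a 0.

(* ------------------------------------------------------------------------ *)
(* Q_p = Z_p[1/p]: the pair (a, n) stands for a / p^n. As p is not a zero    *)
(* divisor in Z_p, a / p^n = b / p^m iff a p^m = b p^n.                      *)
(* ------------------------------------------------------------------------ *)

Fact frac_add_aux (R : comNzRingType) (x y x' y' X Y X' Y' : R) :
  y' * Y = y * Y' -> x' * X = x * X' ->
  (x * Y + y * X) * (X' * Y') = (x' * Y' + y' * X') * (X * Y).
Proof.
move=> ey ex.
transitivity ((x * X') * (Y * Y') + (y * Y') * (X * X')); first by ring.
by rewrite -ex -ey; ring.
Qed.

Fact frac_mulDl_aux (R : comNzRingType) (x y z X Y Z : R) :
  (x * Y + y * X) * z * (X * Z * (Y * Z)) =
  (x * z * (Y * Z) + y * z * (X * Z)) * (X * Y * Z).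
Proof. by ring. Qed.

Section PadicFrac.
Local Open Scope quotient_scope.
Variables (p : nat) (p_gt1 : (1 < p)%N).
Local Notation Zp := (padic p_gt1).
Local Notation frac := (Zp * nat)%type.
Local Notation P := (p%:R : Zp).
Implicit Types x y z : frac.

Definition fraceq x y := x.1 * P ^+ y.2 == y.1 * P ^+ x.2.

Fact fraceq_refl : reflexive fraceq.
Proof. by move=> x; rewrite /fraceq. Qed.
Fact fraceq_sym : symmetric fraceq.
Proof. by move=> x y; rewrite /fraceq eq_sym. Qed.
Fact fraceq_trans : transitive fraceq.
Proof.
move=> y x z /eqP xy /eqP yz; apply/eqP; apply: (@mulpX_inj _ _ y.2) => /=.
by rewrite mulrAC xy mulrAC yz mulrAC.
Qed.
Canonical fraceq_equiv := EquivRel fraceq fraceq_refl fraceq_sym fraceq_trans.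

Definition padic_frac := {eq_quot fraceq}.
HB.instance Definition _ : EqQuotient _ fraceq padic_frac :=
  EqQuotient.on padic_frac.
HB.instance Definition _ := Choice.on padic_frac.
Local Notation Qp := padic_frac.

Lemma frac_repr x : (repr (\pi_Qp x)).1 * P ^+ x.2 = x.1 * P ^+ (repr (\pi_Qp x)).2.
Proof. by apply/eqP; rewrite -[_ == _]/(fraceq _ _) -eqmodE reprK. Qed.

Definition frac_add x y : frac := (x.1 * P ^+ y.2 + y.1 * P ^+ x.2, (x.2 + y.2)%N).
Definition frac_opp x : frac := (- x.1, x.2).
Definition frac_mul x y : frac := (x.1 * y.1, (x.2 + y.2)%N).

Definition Qp_add := lift_op2 Qp frac_add.
Definition Qp_opp := lift_op1 Qp frac_opp.
Definition Qp_mul := lift_op2 Qp frac_mul.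
Definition padic_to_frac := lift_embed Qp (fun a : Zp => ((a, 0%N) : frac)).
Canonical padic_to_frac_pi := PiEmbed padic_to_frac.

Fact pi_frac_add : {morph \pi : x y / frac_add x y >-> Qp_add x y}.
Proof.
move=> x y; unlock Qp_add; apply/eqmodP; rewrite /= /fraceq /=; apply/eqP.
have := frac_repr x; have := frac_repr y.
set x' := repr _; set y' := repr _ => ey ex.
rewrite !exprD; exact: frac_add_aux.
Qed.
Canonical pi_frac_add_morph := PiMorph2 pi_frac_add.

Fact pi_frac_opp : {morph \pi : x / frac_opp x >-> Qp_opp x}.
Proof.
move=> x; unlock Qp_opp; apply/eqmodP; rewrite /= /fraceq /=; apply/eqP.
by rewrite !mulNr -frac_repr.
Qed.
Canonical pi_frac_opp_morph := PiMorph1 pi_frac_opp.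

Fact pi_frac_mul : {morph \pi : x y / frac_mul x y >-> Qp_mul x y}.
Proof.
move=> x y; unlock Qp_mul; apply/eqmodP; rewrite /= /fraceq /=; apply/eqP.
by rewrite !exprD mulrACA -!frac_repr mulrACA.
Qed.
Canonical pi_frac_mul_morph := PiMorph2 pi_frac_mul.

Fact Qp_addA : associative Qp_add.
Proof.
elim/quotW=> x; elim/quotW=> y; elim/quotW=> z; rewrite !piE.
congr (\pi _); rewrite /frac_add /= addnA; congr (_, _).
rewrite !exprD !mulrDl !mulrA addrA; congr (_ + _ + _).
  by rewrite mulrAC.
by rewrite mulrAC.
Qed.
Fact Qp_addC : commutative Qp_add.
Proof.
by elim/quotW=> x; elim/quotW=> y; rewrite !piE /frac_add addrC addnC.
Qed.
Fact Qp_add0 : left_id (padic_to_frac 0) Qp_add.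
Proof.
elim/quotW=> x; rewrite !piE /frac_add /= mul0r add0r mulr1.
by case: x.
Qed.
Fact Qp_addN : left_inverse (padic_to_frac 0) Qp_opp Qp_add.
Proof.
elim/quotW=> x; rewrite !piE; apply/eqmodP; rewrite /= /fraceq /=.
by rewrite mulNr addNr !mul0r.
Qed.
HB.instance Definition _ :=
  GRing.isZmodule.Build padic_frac Qp_addA Qp_addC Qp_add0 Qp_addN.

Fact Qp_mulA : associative Qp_mul.
Proof.
elim/quotW=> x; elim/quotW=> y; elim/quotW=> z; rewrite !piE.
by rewrite /frac_mul /= mulrA addnA.
Qed.
Fact Qp_mulC : commutative Qp_mul.
Proof.
by elim/quotW=> x; elim/quotW=> y; rewrite !piE /frac_mul mulrC addnC.
Qed.
Fact Qp_mul1 : left_id (padic_to_frac 1) Qp_mul.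
Proof. by elim/quotW=> x; rewrite !piE /frac_mul /= mul1r; case: x. Qed.
Fact Qp_mulDl : left_distributive Qp_mul Qp_add.
Proof.
elim/quotW=> x; elim/quotW=> y; elim/quotW=> z; rewrite !piE.
apply/eqmodP; rewrite /= /fraceq /frac_add /frac_mul /=; apply/eqP.
rewrite !exprD; exact: frac_mulDl_aux.
Qed.
Fact Qp_1neq0 : padic_to_frac 1 != 0.
Proof.
rewrite -[0]/(padic_to_frac 0) !piE /= /fraceq /= !mulr1.
exact: oner_neq0.
Qed.
HB.instance Definition _ := GRing.Zmodule_isComNzRing.Build padic_frac
  Qp_mulA Qp_mulC Qp_mul1 Qp_mulDl Qp_1neq0.

Fact padic_to_frac_zmod_morphism : zmod_morphism padic_to_frac.
Proof.
move=> a b; rewrite -[RHS]/(Qp_add _ (Qp_opp _)) !piE.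
by rewrite /frac_add /frac_opp /= !mulr1.
Qed.
HB.instance Definition _ := GRing.isZmodMorphism.Build (padic p_gt1) padic_frac
  padic_to_frac padic_to_frac_zmod_morphism.

Fact padic_to_frac_monoid_morphism : monoid_morphism padic_to_frac.
Proof. by split=> // a b; rewrite -[RHS]/(Qp_mul _ _) !piE. Qed.
HB.instance Definition _ := GRing.isMonoidMorphism.Build (padic p_gt1) padic_frac
  padic_to_frac padic_to_frac_monoid_morphism.

Lemma padic_to_frac_inj : injective padic_to_frac.
Proof.
by move=> a b; rewrite !piE => /eqmodP/eqP /=; rewrite !expr0 !mulr1.
Qed.

Definition Qp_unit : pred padic_frac := fun x : padic_frac =>
  `[< exists y : padic_frac, y * x = 1 >].
Definition Qp_inv (x : padic_frac) : padic_frac :=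
  xget x [set y : padic_frac | y * x = 1].

Fact Qp_mulVx : {in Qp_unit, left_inverse 1 Qp_inv *%R}.
Proof.
move=> x /asboolP[y yx]; rewrite /Qp_inv.
by case: xgetP => [z _ // | /(_ y)].
Qed.
Fact Qp_unitPl (x y : padic_frac) : y * x = 1 -> Qp_unit x.
Proof. by move=> yx; apply/asboolP; exists y. Qed.
Fact Qp_inv_out : {in [predC Qp_unit], Qp_inv =1 id}.
Proof.
move=> x /= /negP xU; rewrite /Qp_inv; case: xgetP => // y _ yx.
by case: xU; apply: (Qp_unitPl yx).
Qed.
HB.instance Definition _ := GRing.ComNzRing_hasMulInverse.Build padic_frac
  Qp_mulVx Qp_unitPl Qp_inv_out.

Lemma unitp : (p%:R : padic_frac) \is a GRing.unit.
Proof.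
apply/unitrP; exists (\pi_padic_frac (1, 1%N)).
have pV : \pi_padic_frac (1, 1%N) * padic_to_frac p%:R = 1.
  rewrite -[LHS]/(Qp_mul _ _) -[RHS]/(padic_to_frac 1) !piE; apply/eqmodP.
  by rewrite /= /fraceq /frac_mul /= !mulr1 !mul1r.
by rewrite -(rmorph_nat padic_to_frac) [X in _ /\ X = _]mulrC pV.
Qed.

Lemma padic_fracE (x : frac) :
  \pi_padic_frac x = padic_to_frac x.1 / p%:R ^+ x.2.
Proof.
have e : \pi_padic_frac x * p%:R ^+ x.2 = padic_to_frac x.1.
  rewrite -(rmorph_nat padic_to_frac) -rmorphXn.
  rewrite -[LHS]/(Qp_mul _ _) !piE; apply/eqmodP.
  by rewrite /= /fraceq /frac_mul /= mulr1 addn0.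
by rewrite -e mulrK // unitrX // unitp.
Qed.
End PadicFrac.

(* The greatest, resp. least, element of A (0 when there is none). *)
Definition max_nat (A : set nat) : nat := xget 0%N (A `&` ubound A).
Definition min_nat (A : set nat) : nat := xget 0%N (A `&` lbound A).

Lemma max_natP (A : set nat) :
  A !=set0 -> has_ubound A -> A (max_nat A) /\ ubound A (max_nat A).
Proof.
move=> [k Ak] [b bA].
have exA : exists n, `[< A n >] by exists k; apply/asboolP.
have boundA n : `[< A n >] -> (n <= b)%N by move=> /asboolP/bA.
rewrite /max_nat; case: xgetP => [n _ //|]; case: (ex_maxnP exA boundA).
by move=> n /asboolP An nA /(_ n)[]; split=> // m Am; apply/nA/asboolP.
Qed.

Lemma min_natP (A : set nat) :
  A !=set0 -> A (min_nat A) /\ lbound A (min_nat A).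
Proof.
move=> [k Ak]; have exA : exists n, `[< A n >] by exists k; apply/asboolP.
rewrite /min_nat; case: xgetP => [n _ //|]; case: (ex_minnP exA).
by move=> n /asboolP An nA /(_ n)[]; split=> // m Am; apply/nA/asboolP.
Qed.

Section Valuation.
Variables (p : nat) (p_gt1 : (1 < p)%N).
Local Notation Zp := (padic p_gt1).
Local Notation Qp := (padic_frac p_gt1).
Local Notation iota := (@padic_to_frac p p_gt1).
Implicit Types x : Qp.

Definition Zp_in_Qp : set Qp := range iota.

(* p-adic valuation, for p not necessarily prime: the largest k >= 0 with   *)
(* x / p^k in Z_p, or minus the least k > 0 with x p^k in Z_p; nu 0 = +oo.   *)
Definition nu x : \bar int :=
  if x == 0 then +oo%E
  else if x \in Zp_in_Qp then
    (max_nat [set k | Zp_in_Qp (x / p%:R ^+ k)])%:Z%:E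
  else (- (min_nat [set k | (0 < k)%N /\ Zp_in_Qp (x * p%:R ^+ k)])%:Z)%:E.

(* The maximum and the minimum in the definition of nu are attained. *)
Lemma nu_max_exists x : x != 0 -> Zp_in_Qp x ->
  let A := [set k | Zp_in_Qp (x / p%:R ^+ k)] in A !=set0 /\ has_ubound A.
Proof.
move=> x0 xZ A; split; first by exists 0%N; rewrite /A /= expr0 divr1.
case: xZ => a _ ax; have a0 : a != 0.
  by apply: contraNneq x0 => a0; rewrite -ax a0 rmorph0.
have [k ak] : exists k, a k <> 0.
  apply: contrapT => H; move/eqP: a0; apply; apply: padic_eqP => k.
  by rewrite residue0; apply: contrapT => ak; apply: H; exists k.
exists k => j [b _ bx]; rewrite leEnat leqNgt; apply/negP => kj; apply: ak.
have -> : a = b * p%:R ^+ j.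
  apply: (@padic_to_frac_inj p p_gt1).
  by rewrite ax rmorphM rmorphXn rmorph_nat /= bx divrK // unitrX // unitp.
rewrite residueM natX residue_nat modzMmr -(subnK (ltnW kj)) expnD PoszM mulrA.
exact: modzMl.
Qed.

Lemma nu_min_exists x :
  [set k | (0 < k)%N /\ Zp_in_Qp (x * p%:R ^+ k)] !=set0.
Proof.
rewrite -(reprK x) padic_fracE; set y := repr x; exists y.2.+1; split => //.
exists (y.1 * p%:R) => //.
by rewrite rmorphM rmorph_nat /= exprSr mulrA divrK // unitrX // unitp.
Qed.

(* - min ({nu(a_i) | 0 <= i <= d} U {0}) for g = sum_(i <= d) a_i x^i;   *)
(* the minimum is a nonpositive integer (lemma denom_expE). Zero             *)
(* coefficients contribute +oo, so the choice of d >= deg g is immaterial.   *)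
Definition min_nu (g : {poly Qp}) : \bar int :=
  \big[Order.min/0%:E]_(i < size g) nu g`_i.

Definition denom_exp (g : {poly Qp}) : nat := `|- fine (min_nu g)|%N.

Lemma denom_expE g : (denom_exp g)%:Z%:E = (- min_nu g)%E.
Proof.
have H : exists2 z : int, min_nu g = z%:E & z <= 0.
  rewrite /min_nu; elim/big_rec: _ => [|i y _ [z -> z0]]; first by exists 0.
  have : nu g`_i = +oo%E \/ exists z, nu g`_i = z%:E.
    rewrite /nu; case: ifP => _; first by left.
    by case: ifP => _; right; eexists.
  case=> [-> | [w ->]]; first by exists z => //; rewrite minye.
  exists (Order.min w z); last by rewrite ge_min z0 orbT.
  by rewrite EFin_min.
have [z e z0] := H; rewrite /denom_exp e /= -[RHS]/((- z)%:E); congr _%:E.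
by rewrite gez0_abs // oppr_ge0.
Qed.

Definition congp (l : nat) (m n : Zp) : Prop :=
  exists c : Zp, m - n = p%:R ^+ l * c.

Definition residue_class (r : nat) : set Zp := [set r%:R + p%:R * c | c in setT].

(* f(n) - (f(n) % p) *)
Definition ftilde (f : Zp -> Zp) (n : Zp) : Zp := f n - (padic_rem (f n))%:~R.

Definition weakly_suitable_at (r : nat) (L : set nat) (f : Zp -> Zp) : Prop :=
  forall l, L l -> forall m n, residue_class r m -> residue_class r n ->
    congp l m n -> congp l (ftilde f m) (ftilde f n).

Definition suitable_at (r : nat) (L : set nat) (f : Zp -> Zp) : Prop :=
  forall l, L l -> forall m n, residue_class r m -> residue_class r n ->
    (congp l m n <-> congp l (ftilde f m) (ftilde f n)).

Definition weakly_suitable r f := weakly_suitable_at r setT f.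
Definition suitable r f := suitable_at r setT f.

Definition witness (r l : nat) : set Zp :=
  [set j%:R | j in [set j : nat | (j < p ^ l)%N]] `&` residue_class r.

End Valuation.

(* Main.v *)
Require Import Defs.
From HB Require Import structures.
From mathcomp Require Import all_boot all_order all_algebra.
From mathcomp Require Import ring.
From mathcomp Require Import boolp classical_sets cardinality constructive_ereal.

(* Let G = p^K g, a polynomial over Z_p. Expanding G to first order gives, for
   j > 0 and n in the residue class of r,
     f(n + p^(K+j) x) - f(n) = p^j (G'(n) x + p^(K+j) t),
   and f may be replaced by f~ there since both sides are divisible by p. Hence
   f~ mod p^k only depends on n mod p^(K+k). Moreover weak suitability at one
   level K+j forces G'(n) = p^K u, so that the increment becomes
   p^(K+j) (u x + p^j t): this gives weak suitability at all higher levels. *)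

Set Implicit Arguments.
Unset Strict Implicit.
Unset Printing Implicit Defensive.

Import Order.TTheory GRing.Theory Num.Theory.
Local Open Scope classical_set_scope.
Local Open Scope ring_scope.

(** For [q * 'X + c], multiply the expansion of [q] by [x + h]: the term q'(x) h^2 moves into the
    new remainder. No factorial is inverted. *)
Lemma horner_taylor1 (R : comNzRingType) (q : {poly R}) (x h : R) :
  exists t, q.[x + h] = q.[x] + q^`().[x] * h + h ^+ 2 * t.
Proof.
elim/poly_ind: q => [|q c [t tE]]; first by exists 0; rewrite deriv0 !horner0; ring.
exists (t * (x + h) + q^`().[x]).
by rewrite !derivE !hornerE tE; ring.
Qed.

Section Padic.
Variables (p : nat) (p_gt1 : (1 < p)%N).
Local Notation Zp := (padic p_gt1).
Local Notation P := (p%:R : Zp).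
Local Notation pk k := ((p ^ k)%N%:Z).
Implicit Types (a b m n : Zp) (r l k : nat).

(** * Congruences modulo [p^l] and integer representatives *)

Lemma residue_addn a l k : (a (k + l)%N %% pk l)%Z = a l.
Proof.
elim: k => [|k IHk]; first exact: padic_mod.
rewrite -[in RHS]IHk -(padic_modS a (k + l)) addSn.
rewrite [in LHS](divz_eq (a (k + l).+1) (pk (k + l))); set q := (_ %/ _)%Z.
by rewrite [q * _]mulrC expnD PoszM mulrAC modzMDl.
Qed.

Lemma residue_eq0_dvd a l : a l = 0 -> exists c, a = P ^+ l * c.
Proof.
move=> al0.
have dvd_a k : (pk l %| a (k + l)%N)%Z.
  by apply/dvdz_mod0P; rewrite residue_addn.
(* Division by [p^l] shifts the residues: residue [k] of the quotient is read off residue [k + l] of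
   [a]. *)
have cH k : ((a (k.+1 + l)%N %/ pk l)%Z %% pk k)%Z
    = ((a (k + l)%N %/ pk l)%Z %% pk k)%Z.
  rewrite addSn (divz_eq (a (k + l).+1) (pk (k + l))) padic_modS.
  set q := (_ %/ pk (k + l))%Z; rewrite expnD PoszM mulrA.
  by rewrite divzMDl ?pk_neq0 // modzMDl.
exists (mk_padic p_gt1 cH); apply: padic_eqP => k.
rewrite residueM natX residue_nat modzMml /= modzMmr mulrC divzK //.
by rewrite addnC residue_addn.
Qed.

(** Turns divisibility into an equality of residues, usable for rewriting. *)
Lemma congpP l a b : congp l a b <-> a l = b l.
Proof.
split=> [[c abE]|abl].
  rewrite -(subrK b a) abE residueD residueM natX residue_nat modzz mul0r.
  by rewrite mod0z add0r padic_mod.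
by apply: residue_eq0_dvd; rewrite residueD residueN modzDmr abl subrr mod0z.
Qed.

Lemma congp0 a b : congp 0 a b.
Proof. by exists (a - b); rewrite expr0 mul1r. Qed.

Lemma congp_le l k a b : (l <= k)%N -> congp k a b -> congp l a b.
Proof.
by move=> lk [c abE]; exists (P ^+ (k - l) * c); rewrite mulrA -exprD subnKC.
Qed.

Lemma congpE l n c : congp l (n + P ^+ l * c) n.
Proof. by exists c; rewrite addrC addKr. Qed.

Lemma congp_exists l m n : congp l m n -> exists c, m = n + P ^+ l * c.
Proof. by case=> c mnE; exists c; rewrite -mnE addrC subrK. Qed.

Lemma residue_class_congp r l m n :
  (0 < l)%N -> congp l m n -> residue_class r n -> residue_class r m.
Proof.
move=> l0 /(congp_le l0)/congp_exists[c ->] [b _ <-]; exists (b + c) => //.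
by rewrite expr1; ring.
Qed.

Lemma congp_natr l n : exists2 j, (j < p ^ l)%N & congp l j%:R n.
Proof.
have /andP[n0 nlt] := padic_range n l.
exists `|n l|%N; first by rewrite -ltz_nat gez0_abs.
by apply/congpP; rewrite residue_nat gez0_abs // padic_mod.
Qed.

Lemma finite_witness r l : finite_set (@witness p p_gt1 r l).
Proof. by apply/finite_setIl/finite_image/finite_II. Qed.

Lemma witness_class r l n : witness r l n -> residue_class r n.
Proof. by case. Qed.

Lemma congp_witness r l n : (0 < l)%N -> residue_class r n ->
  exists2 m, witness r l m & congp l m n.
Proof.
move=> l0 rn; have [j jl jn] := congp_natr l n; exists j%:R => //.
by split; [exists j | apply: residue_class_congp jn rn].
Qed.

(** The digit subtracted by [ftilde] depends only on the value of [f] modulo [p], so it cancels. *)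
Lemma ftildeB (f : Zp -> Zp) m n :
  congp 1 (f m) (f n) -> ftilde f m - ftilde f n = f m - f n.
Proof.
move/congpP => fmn; rewrite /ftilde /padic_rem /digit fmn; ring.
Qed.

Lemma weakly_suitable_atP r (L : set nat) (f : Zp -> Zp) :
  weakly_suitable_at r L f <-> forall l, L l -> weakly_suitable_at r [set l] f.
Proof.
split=> [fL l Ll _ ->|fL l Ll]; first exact: fL.
exact: (fL l Ll l).
Qed.

Lemma suitable_atP r (L : set nat) (f : Zp -> Zp) :
  suitable_at r L f <-> forall l, L l -> suitable_at r [set l] f.
Proof.
split=> [fL l Ll _ ->|fL l Ll]; first exact: fL.
exact: (fL l Ll l).
Qed.

Lemma suitable_at_weakly r (L : set nat) (f : Zp -> Zp) :
  suitable_at r L f -> weakly_suitable_at r L f.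
Proof. by move=> fL l Ll m n rm rn /(fL l Ll m n rm rn). Qed.

(** * First-order increments of [ftilde f] *)

Section IntegralNumerator.
Variables (r : nat) (f : Zp -> Zp) (K : nat) (G : {poly Zp}).
Hypothesis fG : forall n, residue_class r n -> P ^+ K * f n = G.[n].

Lemma ftilde_taylor n x j : (0 < j)%N -> residue_class r n ->
  exists t, ftilde f (n + P ^+ (K + j) * x) - ftilde f n
            = P ^+ j * (G^`().[n] * x + P ^+ (K + j) * t).
Proof.
move=> j0 rn; set m := n + _.
have rm : residue_class r m.
  by apply: residue_class_congp (congpE _ _ _) rn; rewrite addn_gt0 j0 orbT.
have [t tE] := horner_taylor1 G n (P ^+ (K + j) * x).
have fmn : f m - f n = P ^+ j * (G^`().[n] * x + P ^+ (K + j) * (x ^+ 2 * t)).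
  (* Multiplication by [p^K] is injective even for composite [p]; of the factor [p^(2(K+j))] in the
     Taylor remainder, [p^(K+2j)] survives. *)
  apply: (@mulpX_inj _ _ K) => /=.
  by rewrite mulrC mulrBr !fG // tE !exprD; ring.
exists (x ^+ 2 * t); rewrite -fmn; apply: ftildeB.
by apply: congp_le j0 _; eexists; exact: fmn.
Qed.

Lemma ftilde_congp m n k : residue_class r n -> congp (K + k) m n ->
  congp k (ftilde f m) (ftilde f n).
Proof.
case: k => [|k] rn; first by move=> _; exact: congp0.
by case/congp_exists=> c ->; have [t] := ftilde_taylor c (ltn0Sn k) rn; eexists; eauto.
Qed.

(** Comparing [n] with [n + p^(K+j)] makes [p^j (G'(n) + p^(K+j) t)] a multiple of [p^(K+j)]; then
    [p^j] is cancelled. *)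
Lemma weakly_suitable_deriv n j : (0 < j)%N ->
  weakly_suitable_at r [set (K + j)%N] f -> residue_class r n ->
  exists u, G^`().[n] = P ^+ K * u.
Proof.
move=> j0 fw rn; have [t tE] := ftilde_taylor 1 j0 rn.
have rm : residue_class r (n + P ^+ (K + j) * 1).
  by apply: residue_class_congp (congpE _ _ _) rn; rewrite addn_gt0 j0 orbT.
have [c] := fw _ erefl _ _ rm rn (congpE _ _ _).
rewrite tE mulr1 => cE; exists (c - P ^+ j * t).
apply: (@mulpX_inj _ _ j); rewrite /= mulrC.
transitivity (P ^+ j * (G^`().[n] + P ^+ (K + j) * t) - P ^+ j * P ^+ (K + j) * t).
  by ring.
by rewrite cE exprD; ring.
Qed.

Lemma ftilde_taylor_suitable n u x j : (0 < j)%N -> residue_class r n ->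
  G^`().[n] = P ^+ K * u ->
  exists t, ftilde f (n + P ^+ (K + j) * x) - ftilde f n
            = P ^+ (K + j) * (u * x + P ^+ j * t).
Proof.
move=> j0 rn uE; have [t ->] := ftilde_taylor x j0 rn.
by exists t; rewrite uE exprD; ring.
Qed.

Lemma weakly_suitable_at_add j i : (0 < j)%N -> (j <= i)%N ->
  weakly_suitable_at r [set (K + j)%N] f ->
  weakly_suitable_at r [set (K + i)%N] f.
Proof.
move=> j0 ji fw _ -> m n rm rn /congp_exists[x ->].
have [u uE] := weakly_suitable_deriv j0 fw rn.
have [t tE] := ftilde_taylor_suitable x (leq_trans j0 ji) rn uE.
by eexists; exact: tE.
Qed.

(* With G'(n) = p^K u, suitability at K + j + 1 says that p | u x implies
   p | x, and this is also what suitability at K + j + 2 amounts to. *)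
Lemma suitable_at_SS j : (1 < j)%N ->
  weakly_suitable_at r [set (K + j)%N] f ->
  suitable_at r [set (K + j).+1] f -> suitable_at r [set (K + j).+2] f.
Proof.
move=> j1 fw fs _ -> m n rm rn; have j0 := ltnW j1; split.
  rewrite -!addnS; exact: (weakly_suitable_at_add j0 (leqW (leqnSn j)) fw).
move=> fmn.
(* Level [K + j + 1] already gives [m = n + p^(K+j+1) x]; it remains to show that [p] divides
   [x]. *)
have /(fs _ erefl m n rm rn)/congp_exists[x mE] :
  congp (K + j).+1 (ftilde f m) (ftilde f n) by apply: congp_le fmn.
have [u uE] := weakly_suitable_deriv j0 fw rn.
have [s] := ftilde_taylor_suitable x (ltn0Sn j) rn uE.
rewrite addnS -mE; case: fmn => c -> /esym cE.
have uxE : u * x = P * (c - P ^+ j * s).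
  apply: (@mulpX_inj _ _ (K + j).+1); rewrite /= mulrC.
  transitivity (P ^+ (K + j).+1 * (u * x + P ^+ j.+1 * s)
                - P ^+ (K + j).+1 * P ^+ j.+1 * s); first by ring.
  by rewrite cE !exprS; ring.
(* The same [x] is now tested one level lower, at [n + p^(K+j) x]: as [p] divides [u x], the
   increment of [ftilde f] is divisible by [p^(K+j+1)], and suitability forces [p] to divide [x]. *)
have [t tE] := ftilde_taylor_suitable x j0 rn uE.
have Kj0 : (0 < K + j)%N by rewrite addn_gt0 j0 orbT.
have rn' := residue_class_congp Kj0 (congpE (K + j) n x) rn.
have /(fs _ erefl _ _ rn' rn)[d dE] :
    congp (K + j).+1 (ftilde f (n + P ^+ (K + j) * x)) (ftilde f n).
  (* The sum of the quotients of [u x] and [p^j t] by [p]; the second exists because [j > 0]. *)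
  exists (c - P ^+ j * s + P ^+ j.-1 * t).
  have Pj : P ^+ j = P * P ^+ j.-1 by rewrite -exprS prednK.
  by rewrite tE uxE exprS; ring: Pj.
have xE : x = P * d.
  apply: (@mulpX_inj _ _ (K + j)); rewrite /= mulrC.
  transitivity (n + P ^+ (K + j) * x - n); first by ring.
  by rewrite dE exprS; ring.
by exists d; rewrite mE xE !exprS; ring.
Qed.

Lemma suitable_at_add_ge2 :
  suitable_at r [set (K + 2)%N; (K + 3)%N] f ->
  forall i, suitable_at r [set (K + i.+2)%N] f.
Proof.
move=> /suitable_atP f23 i.
have f2 : suitable_at r [set (K + 2)%N] f by apply: f23; left.
have f3 : suitable_at r [set (K + 3)%N] f by apply: f23; right.
(* The induction carries two consecutive levels, since [suitable_at_SS] consumes both. *)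
suff [] : suitable_at r [set (K + i.+2)%N] f /\ suitable_at r [set (K + i.+3)%N] f.
  by [].
elim: i => [//|i [fi fSi]]; split=> //; rewrite addnS addnS.
apply: suitable_at_SS; last by rewrite -addnS.
- by [].
- exact: suitable_at_weakly.
Qed.

(** Passing to representatives modulo [p^(K+k)] changes neither the points nor, by [ftilde_congp],
    their images under [ftilde f] modulo [p^k]. *)
Lemma weakly_suitable_witness k :
  weakly_suitable_at r [set k] f <->
  forall m n, witness r (K + k) m -> witness r (K + k) n ->
    congp k m n -> congp k (ftilde f m) (ftilde f n).
Proof.
split=> [fw m n /witness_class rm /witness_class rn|fw _ -> m n rm rn mn].
  exact: fw.
(* Level 0 is separate: if [K = 0] too, a representative modulo [p^0] may leave the class of [r],
   but congruence modulo 1 is trivial. *)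
case: k fw mn => [_ _|k fw mn]; first exact: congp0.
have K0 : (0 < K + k.+1)%N by rewrite addnS.
have [m' m'W m'm] := congp_witness K0 rm.
have [n' n'W n'n] := congp_witness K0 rn.
have /congpP fm := ftilde_congp rm m'm; have /congpP fn := ftilde_congp rn n'n.
have /congpP ml := congp_le (leq_addl _ _) m'm.
have /congpP nl := congp_le (leq_addl _ _) n'n.
apply/congpP; rewrite -fm -fn; apply/congpP; apply: fw => //.
by apply/congpP; rewrite ml nl; apply/congpP.
Qed.

Lemma suitable_witness k :
  suitable_at r [set k] f <->
  forall m n, witness r (K + k) m -> witness r (K + k) n ->
    (congp k m n <-> congp k (ftilde f m) (ftilde f n)).
Proof.
split=> [fw m n /witness_class rm /witness_class rn|fw _ -> m n rm rn].
  exact: fw.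
case: k fw => [_|k fw]; first by split=> _; exact: congp0.
have K0 : (0 < K + k.+1)%N by rewrite addnS.
have [m' m'W m'm] := congp_witness K0 rm.
have [n' n'W n'n] := congp_witness K0 rn.
have /congpP fm := ftilde_congp rm m'm; have /congpP fn := ftilde_congp rn n'n.
have /congpP ml := congp_le (leq_addl _ _) m'm.
have /congpP nl := congp_le (leq_addl _ _) n'n.
by have := fw m' n' m'W n'W; rewrite !congpP ml nl fm fn.
Qed.

End IntegralNumerator.

(** * Clearing the denominators of [g] *)

Lemma nu_bound (x : padic_frac p_gt1) k :
  ((- k%:Z)%R%:E <= nu x)%E -> Zp_in_Qp (p%:R ^+ k * x).
Proof.
rewrite /nu; case: eqP => [-> _|x0].
  by exists 0 => //; rewrite mulr0 rmorph0.
case: ifPn => [/set_mem[a _ <-] _|_].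
  by exists (P ^+ k * a) => //; rewrite rmorphM rmorphXn rmorph_nat.
(* The minimum defining [nu x] is attained, so it is an exponent clearing the denominator of [x];
   the hypothesis says that [k] is at least this exponent. *)
have [[_ [a _ aE]] _] := min_natP (nu_min_exists x).
rewrite lee_fin lerN2 lez_nat => jk.
exists (P ^+ (k - min_nat [set k | (0 < k)%N /\ Zp_in_Qp (x * p%:R ^+ k)]) * a) => //.
by rewrite rmorphM rmorphXn rmorph_nat /= aE mulrCA -exprD subnK // mulrC.
Qed.

Lemma denom_exp_integral (g : {poly padic_frac p_gt1}) i :
  Zp_in_Qp (p%:R ^+ denom_exp g * g`_i).
Proof.
have [ig|gi] := ltnP i (size g); last first.
  by exists 0 => //; rewrite nth_default // mulr0 rmorph0.
apply: nu_bound; have -> : (- (denom_exp g)%:Z)%:E = min_nu g.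
  by rewrite EFinN denom_expE oppeK.
exact: (bigmin_le_cond _ (fun i : 'I_(size g) => nu g`_i) (erefl : xpredT (Ordinal ig))).
Qed.

Lemma integral_numerator (g : {poly padic_frac p_gt1}) :
  exists G : {poly Zp},
    map_poly (@padic_to_frac p p_gt1) G = p%:R ^+ denom_exp g *: g.
Proof.
have /choice[b bE] i : exists c : Zp,
    padic_to_frac c = p%:R ^+ denom_exp g * g`_i.
  by have [c _ cE] := denom_exp_integral g i; exists c.
exists (\poly_(i < size g) b i); apply/polyP => i.
rewrite coef_map coef_poly coefZ; case: ltnP => [_|gi]; first exact: bE.
by rewrite nth_default // mulr0 raddf0.
Qed.

End Padic.

Theorem theorem4p10 (p : nat) (p_gt1 : (1 < p)%N) (r : nat) (r_lt_p : (r < p)%N)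
    (f : padic p_gt1 -> padic p_gt1) (g : {poly padic_frac p_gt1})
    (g_int : forall n : padic p_gt1, residue_class r n ->
       Zp_in_Qp g.[padic_to_frac n])
    (fg : forall n : padic p_gt1, residue_class r n ->
       padic_to_frac (f n) = g.[padic_to_frac n])
    (k : nat) :
  let W : nat -> set (padic p_gt1) := witness r in
  let K := denom_exp g in
  finite_set (W (K + k)%N) /\
  (* (1) *)
  (weakly_suitable_at r [set k] f <->
     forall m n, W (K + k)%N m -> W (K + k)%N n ->
       congp k m n -> congp k (ftilde f m) (ftilde f n)) /\
  (* (2) *)
  (suitable_at r [set k] f <->
     forall m n, W (K + k)%N m -> W (K + k)%N n ->
       (congp k m n <-> congp k (ftilde f m) (ftilde f n))) /\
  (* (3) *)
  (forall l, (K + 1 <= l)%N ->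
     weakly_suitable_at r [set l] f -> weakly_suitable_at r [set l.+1] f) /\
  (weakly_suitable_at r [set l | (K + 1 <= l)%N] f <->
     weakly_suitable_at r [set (K + 1)%N] f) /\
  (* (4) *)
  (forall l, (K + 2 <= l)%N ->
     weakly_suitable_at r [set l] f -> suitable_at r [set l.+1] f ->
     suitable_at r [set l.+2] f) /\
  (suitable_at r [set l | (K + 2 <= l)%N] f <->
     suitable_at r [set (K + 2)%N; (K + 3)%N] f) /\
  (* (1') *)
  ((weakly_suitable r f <->
      weakly_suitable_at r [set l | (l <= K + 1)%N] f) /\
   (weakly_suitable_at r [set l | (l <= K + 1)%N] f <->
      forall l, (l <= K + 1)%N -> forall m n, W (K + l)%N m -> W (K + l)%N n ->
        congp l m n -> congp l (ftilde f m) (ftilde f n))) /\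
  (* (2') *)
  ((suitable r f <-> suitable_at r [set l | (l <= K + 3)%N] f) /\
   (suitable_at r [set l | (l <= K + 3)%N] f <->
      forall l, (l <= K + 3)%N -> forall m n, W (K + l)%N m -> W (K + l)%N n ->
        (congp l m n <-> congp l (ftilde f m) (ftilde f n)))).
Proof.
move=> W K; have [G GE] := integral_numerator g.
(* Checked in [Q_p], then pulled back along the injective embedding of [Z_p]. *)
have fG n : residue_class r n -> p%:R ^+ K * f n = G.[n].
  move=> rn; apply: (@padic_to_frac_inj p p_gt1).
  rewrite rmorphM rmorphXn rmorph_nat /= fg // -hornerZ -GE.
  by rewrite horner_map.
have weakP l := weakly_suitable_witness fG l.
have suitP l := suitable_witness fG l.
have weak_ge l i : (K + 1 <= l <= i)%N ->
    weakly_suitable_at r [set l] f -> weakly_suitable_at r [set i] f.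
  case/andP=> Kl li; have Kl' : (K <= l)%N by rewrite (leq_trans _ Kl) ?leq_addr.
  (* Levels take the form [K + j] with [j = l - K], and [K + 1 <= l] becomes [j > 0]. *)
  rewrite -(subnKC Kl') -(subnKC (leq_trans Kl' li)).
  by apply: (weakly_suitable_at_add fG); rewrite ?leq_sub2r // subn_gt0 -addn1.
have suit_ge i : (K + 2 <= i)%N ->
    suitable_at r [set (K + 2)%N; (K + 3)%N] f -> suitable_at r [set i] f.
  move=> Ki /(suitable_at_add_ge2 fG)/(_ (i - (K + 2))%N).
  by rewrite -addn2 addnCA subnK.
split; first exact: finite_witness.
split; first exact: weakP.
split; first exact: suitP.
split; first by move=> l Kl; apply: weak_ge; rewrite Kl leqnSn.
split.
  split=> [/weakly_suitable_atP fw|fw]; first exact/fw/leqnn.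
  by apply/weakly_suitable_atP => l Kl; apply: weak_ge fw; rewrite leqnn.
split.
  move=> l Kl; have Kl' : (K <= l)%N by rewrite (leq_trans _ Kl) ?leq_addr.
  rewrite -(subnKC Kl'); apply: (suitable_at_SS fG).
  by rewrite ltn_subRL addn1 -addn2.
split.
  split=> [/suitable_atP fs|fs].
    by apply/suitable_atP => l [] ->; apply: fs => //=; rewrite leq_add2l.
  by apply/suitable_atP => l Kl; apply: suit_ge.
split.
  split; last first.
    by rewrite weakly_suitable_atP; split=> fw l lK; apply/weakP/fw.
  split=> /weakly_suitable_atP fw; apply/weakly_suitable_atP => l lK.
    exact: fw.
  (* Levels above [K + 1] are all inherited from level [K + 1] itself. *)
  have [/fw //|Kl] := leqP l (K + 1).
  by apply: (weak_ge (K + 1)%N); [rewrite leqnn ltnW | apply/fw/leqnn].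
split; last by rewrite suitable_atP; split=> fs l lK; apply/suitP/fs.
split=> /suitable_atP fs; apply/suitable_atP => l lK; first exact: fs.
(* Levels above [K + 3] follow from the pair [K + 2], [K + 3], both in the given range. *)
have [/fs //|Kl] := leqP l (K + 3).
apply: suit_ge; first by rewrite ltnW // (leq_trans _ Kl) // ltnS leq_add2l.
by apply/suitable_atP => i [] ->; apply: fs => //=; rewrite leq_add2l.
Qed.
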